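(* Let $q$ be a prime power. The class of $GF(q)$-projective targets is exactly the class of matroids that can be obtained from the empty matroid by a sequence of operations each of which is a (tipped) $q$-coning or a tipless $q$-coning.
   Context: Write $P_r$ for $PG(r-1,q)$. For a subset $G$ of $E(P_r)$ let $R=E(P_r)-G$ (points of $G$ are ''green'', of $R$ ''red''). The matroid $P_r|G$ is a projective target if there is a chain of flats $F_0\subseteq F_1\subseteq\cdots\subseteq F_r$ of $P_r$ with $r(F_j)=j$ for all $j$ such that for each $i\in\{1,\dots,r\}$ the set $F_i-F_{i-1}$ is contained in $G$ or contained in $R$. Conings are described via colorings: given a 2-coloring $(G,R)$ of $P_r$ with $P_r|G\cong M$, view $P_r$ as a hyperplane $H$ of $P_{r+1}$, choose a point $p\notin H$, and for each point $z$ of $H$ color the other point $z'$ on the line through $p$ and $z$ with the color of $z$; for the tipped $q$-coning color $p$ green, for the tipless $q$-coning color $p$ red; the resulting matroid is the restriction of $P_{r+1}$ to the green points. Equivalently, the tipped $q$-coning $A(M)$ adds a coloop $p$ and all points on projective lines between $p$ and points of $M$, and the tipless coning is $A(M)\backslash p$. *)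

(* Defs.v *)
From HB Require Import structures.
From mathcomp Require Import all_boot all_order all_algebra.

Set Implicit Arguments.
Unset Strict Implicit.
Unset Printing Implicit Defensive.

Definition prime_power (q : nat) : Prop :=
  exists p k : nat, [/\ prime p, 0 < k & q = p ^ k].

(* Finite matroids, axiomatised by their rank function. *)
Record matroid := Matroid {
  ground :> finType;
  rk : {set ground} -> nat;
  rk_card : forall A : {set ground}, rk A <= #|A|;
  rk_mono : forall A B : {set ground}, A \subset B -> rk A <= rk B;
  rk_submod : forall A B : {set ground}, rk (A :|: B) + rk (A :&: B) <= rk A + rk B }.

Arguments rk {m} _.

Section Matroids.
Implicit Types M N : matroid.

Definition closure M (A : {set M}) : {set M} := [set x | rk (x |: A) == rk A].

Definition flat M (A : {set M}) : bool := closure A == A.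

Definition hyperplane M (A : {set M}) : bool :=
  flat A && ((rk A).+1 == rk [set: M]).

Definition matroid_iso M N : Prop :=
  exists f : M -> N,
    bijective f /\ forall A : {set M}, rk (f @: A) = rk A.

Section Restriction.
Variables (M : matroid) (G : {set M}).

Definition restr_rk (A : {set {x : M | x \in G}}) : nat := rk (val @: A).

Fact restr_card (A : {set {x : M | x \in G}}) : restr_rk A <= #|A|.
Proof. by rewrite /restr_rk -(card_imset _ val_inj) rk_card. Qed.

Fact restr_mono (A B : {set {x : M | x \in G}}) :
  A \subset B -> restr_rk A <= restr_rk B.
Proof. by move=> sAB; apply/rk_mono/imsetS. Qed.

Fact restr_submod (A B : {set {x : M | x \in G}}) :
  restr_rk (A :|: B) + restr_rk (A :&: B) <= restr_rk A + restr_rk B.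
Proof.
by rewrite /restr_rk imsetU (imsetI (in2W val_inj)) rk_submod.
Qed.

Definition restriction : matroid := Matroid restr_card restr_mono restr_submod.

End Restriction.

Definition empty_matroid : matroid.
Proof.
by refine (@Matroid void (fun _ => 0) _ _ _).
Defined.

End Matroids.

Section ProjectiveGeometry.
Variables (F : finFieldType) (r : nat).

(* A point of PG(r-1, F) is a line through the origin of F^r, encoded as the
   canonical matrix (a fixed point of genmx) whose row space is that line. *)
Definition pg_point : finType :=
  {A : 'M[F]_r | (<<A>>%MS == A) && (\rank A == 1)}.

Definition pg_rk (A : {set pg_point}) : nat :=
  \rank (\sum_(x in A) val x)%MS.

Fact pg_rk_card (A : {set pg_point}) : pg_rk A <= #|A|.
Proof.
rewrite /pg_rk -sum1_card.
apply: (@big_ind2 _ _ (fun (U : 'M[F]_r) n => \rank U <= n)).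
- by rewrite mxrank0.
- move=> U m V n leUm leVn; apply: leq_trans (leq_add leUm leVn).
  exact: mxrank_adds_leqif.
- by move=> x _; case/andP: (valP x) => _ /eqP ->.
Qed.

Fact pg_rk_mono (A B : {set pg_point}) : A \subset B -> pg_rk A <= pg_rk B.
Proof.
move=> /subsetP sAB; apply: mxrankS; apply/sumsmx_subP => x Ax.
exact: (sumsmx_sup x (sAB x Ax) (submx_refl _)).
Qed.

Fact pg_rk_submod (A B : {set pg_point}) :
  pg_rk (A :|: B) + pg_rk (A :&: B) <= pg_rk A + pg_rk B.
Proof.
rewrite /pg_rk -[leqRHS]mxrank_sum_cap leq_add //; apply: mxrankS.
  apply/sumsmx_subP => x; rewrite inE => /orP[Ax | Bx].
    exact: submx_trans (sumsmx_sup x Ax (submx_refl _)) (addsmxSl _ _).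
  exact: submx_trans (sumsmx_sup x Bx (submx_refl _)) (addsmxSr _ _).
apply/sumsmx_subP => x; rewrite inE => /andP[Ax Bx].
by rewrite sub_capmx (sumsmx_sup x Ax) // (sumsmx_sup x Bx).
Qed.

(* P_r = PG(r-1, F), of rank r. *)
Definition PG : matroid := Matroid pg_rk_card pg_rk_mono pg_rk_submod.

(* Red points are those outside G. *)
Definition target_coloring (G : {set PG}) : Prop :=
  exists Fl : nat -> {set PG},
    [/\ forall j, j <= r -> flat (Fl j) /\ rk (Fl j) = j,
        forall j, j < r -> Fl j \subset Fl j.+1
      & forall i, 0 < i <= r ->
          (Fl i :\: Fl i.-1 \subset G) || (Fl i :\: Fl i.-1 \subset ~: G)].

End ProjectiveGeometry.

Definition projective_target (F : finFieldType) (M : matroid) : Prop :=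
  exists (r : nat) (G : {set PG F r}),
    target_coloring G /\ matroid_iso M (restriction G).

(* P_r viewed as a hyperplane of P_(r+1). *)
Definition hyperplane_embedding (F : finFieldType) (r : nat)
    (iota : PG F r -> PG F r.+1) : Prop :=
  [/\ injective iota,
      forall A : {set PG F r}, rk (iota @: A) = rk A
    & hyperplane (iota @: [set: PG F r])].

(* Every point other than p takes the color of the point iota z in which the
   line joining it to p meets the hyperplane; p is green iff tip. *)
Definition coning_green (F : finFieldType) (r : nat) (G : {set PG F r})
    (iota : PG F r -> PG F r.+1) (p : PG F r.+1) (tip : bool) :
    {set PG F r.+1} :=
  [set x | if x == p then tip
           else [exists z in G, x \in closure [set p; iota z]]].

(* N is a q-coning of M: the coloring (in particular the rank r), the
   hyperplane and the apex p are arbitrary. *)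
Definition q_coning (F : finFieldType) (tip : bool) (M N : matroid) : Prop :=
  exists (r : nat) (G : {set PG F r}) (iota : PG F r -> PG F r.+1)
         (p : PG F r.+1),
    [/\ matroid_iso M (restriction G),
        hyperplane_embedding iota,
        p \notin iota @: [set: PG F r]
      & matroid_iso N (restriction (coning_green G iota p tip))].

Definition tipped_q_coning (F : finFieldType) := @q_coning F true.
Definition tipless_q_coning (F : finFieldType) := @q_coning F false.

Inductive obtained_by_conings (F : finFieldType) : matroid -> Prop :=
| Obtained_empty M :
    matroid_iso M empty_matroid -> obtained_by_conings F M
| Obtained_tipped M N :
    obtained_by_conings F M -> tipped_q_coning F M N ->
    obtained_by_conings F N
| Obtained_tipless M N :
    obtained_by_conings F M -> tipless_q_coning F M N ->
    obtained_by_conings F N.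

(* Main.v *)
Require Import Defs.
From mathcomp Require Import all_boot all_order all_algebra.
From mathcomp Require Import mxabelem.

(* A target coloring of rank r + 1 is a coning: let p be the point F_1. Every layer
   F_i - F_(i-1) with i > 1 is a union of lines through p with p removed, so the
   coloring is recovered from p and from its trace on any hyperplane avoiding p,
   and this trace is a target coloring of rank r.

   Conversely the cones p + F_i over the flats of a target coloring form the
   required chain. A coning may however start from any embedding of M in a
   projective geometry, so being a target coloring must be shown to depend only
   on the matroid. If the top layer U - V of a chain is green, it is an affine
   geometry; its image in another embedding has q^(r U - 1) points and contains no
   full line, and counting forces such a set to be the complement of a hyperplane
   of its span, so that one may proceed by induction on the rank. *)

Set Implicit Arguments.
Unset Strict Implicit.
Unset Printing Implicit Defensive.

Import GRing.Theory.

(** * Points and flats of the projective geometry as row spaces *)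

Section Points.
Variables (F : finFieldType) (n : nat).
Implicit Types (x y z p : pg_point F n) (A B : {set pg_point F n}).

Definition pts m (U : 'M[F]_(m, n)) : {set pg_point F n} :=
  [set x | (val x <= U)%MS].

(** The same sum as in [pg_rk], so that [rk A] unfolds to the rank of this matrix. *)
Definition ptspan A : 'M[F]_n := (\sum_(x in A) val x)%MS.

Lemma rank_pt x : \rank (val x) = 1.
Proof. by case/andP: (valP x) => _ /eqP. Qed.

Lemma pt_neq0 x : val x != 0%R.
Proof. by rewrite -mxrank_eq0 rank_pt. Qed.

(** Comparable points have the same row space because both have rank 1, and a canonical matrix is
    determined by its row space. *)
Lemma pt_eq x y : (val x <= val y)%MS -> x = y.
Proof.
move=> sxy; apply: val_inj.
case/andP: (valP x) (valP y) => /eqP <- _ /andP[/eqP <- _].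
by apply/genmxP; rewrite -(mxrank_leqif_eq sxy).2 !rank_pt.
Qed.

Lemma ptE x y : (val x <= val y)%MS = (x == y).
Proof. by apply/idP/eqP=> [/pt_eq | ->]. Qed.

Lemma pt_of m (A : 'M[F]_(m, n)) :
  \rank A = 1 -> exists x : pg_point F n, (val x :=: A)%MS.
Proof.
move=> rA.
have gA : (<<<<A>>>>%MS == <<A>>%MS) && (\rank <<A>>%MS == 1).
  by rewrite genmx_id eqxx genmxE rA.
by exists (Sub <<A>>%MS gA) => /=; apply: genmxE.
Qed.

Lemma pt_below m (A : 'M[F]_(m, n)) :
  A != 0%R -> exists x : pg_point F n, (val x <= A)%MS.
Proof.
move=> nzA; have [|x ex] := @pt_of _ (nz_row A).
  by rewrite rank_rV nz_row_eq0 nzA.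
by exists x; rewrite ex nz_row_sub.
Qed.

Lemma pt_row x (v : 'rV[F]_n) : v != 0%R -> (v <= val x)%MS -> (v :=: val x)%MS.
Proof.
move=> nzv svx; apply/eqmxP.
by rewrite -(mxrank_leqif_eq svx).2 rank_pt rank_rV nzv.
Qed.

Lemma ptspan_sub m (U : 'M[F]_(m, n)) A : (ptspan A <= U)%MS = (A \subset pts U).
Proof.
by apply/sumsmx_subP/subsetP => sAU x Ax; have:= sAU x Ax; rewrite inE.
Qed.

Lemma sub_ptspan x A : x \in A -> (val x <= ptspan A)%MS.
Proof. by move=> Ax; apply: (sumsmx_sup x). Qed.

Lemma ptspanS A B : A \subset B -> (ptspan A <= ptspan B)%MS.
Proof.
move/subsetP=> sAB; rewrite ptspan_sub; apply/subsetP=> x /sAB.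
by rewrite inE; apply: sub_ptspan.
Qed.

Lemma ptspan_pts m (U : 'M[F]_(m, n)) : (ptspan (pts U) :=: U)%MS.
Proof.
apply/eqmxP; rewrite ptspan_sub subxx /=; apply/row_subP=> i.
have [-> | nz] := eqVneq (row i U) 0%R; first exact: sub0mx.
have [|x ex] := @pt_of _ (row i U); first by rewrite rank_rV nz.
by rewrite -ex; apply: sub_ptspan; rewrite inE ex row_sub.
Qed.

Lemma ptspan_setU A B : (ptspan (A :|: B) :=: ptspan A + ptspan B)%MS.
Proof.
apply/eqmxP; apply/andP; split; last first.
  by rewrite addsmx_sub !ptspanS ?subsetUl ?subsetUr.
rewrite ptspan_sub.
apply/subsetP=> x; rewrite !inE => /orP[] /sub_ptspan sx.
  by apply: submx_trans sx (addsmxSl _ _).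
by apply: submx_trans sx (addsmxSr _ _).
Qed.

Lemma ptspan_set1 x : ptspan [set x] = val x.
Proof. by rewrite /ptspan big_set1. Qed.

Lemma ptspan_set2 x y : (ptspan [set x; y] :=: val x + val y)%MS.
Proof. by apply: eqmx_trans (ptspan_setU _ _) _; rewrite !ptspan_set1. Qed.

Lemma cap_pt m (V : 'M[F]_(m, n)) x :
  ~~ (val x <= V)%MS -> (V :&: val x)%MS = 0%R.
Proof.
move=> nVx; apply/eqP/contraT=> /pt_below[y]; rewrite sub_capmx ptE.
by case/andP=> Vy /eqP eyx; rewrite -eyx Vy in nVx.
Qed.

Lemma rank_add_pt m (V : 'M[F]_(m, n)) x :
  ~~ (val x <= V)%MS -> \rank (V + val x)%MS = (\rank V).+1.
Proof.
move=> nVx; have:= mxrank_sum_cap V (val x).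
by rewrite cap_pt // mxrank0 addn0 rank_pt addn1.
Qed.

Lemma rank_span2 x y : x != y -> \rank (val x + val y)%MS = 2.
Proof. by move=> nxy; rewrite rank_add_pt ?rank_pt // ptE eq_sym. Qed.

(** Adding [x] keeps the rank exactly when it keeps the span. *)
Lemma closureE (A : {set PG F n}) : Defs.closure A = pts (ptspan A).
Proof.
apply/setP=> x; rewrite !inE.
change (\rank (ptspan (x |: A)) == \rank (ptspan A) = (val x <= ptspan A)%MS).
have sA : (ptspan A <= ptspan (x |: A))%MS by apply/ptspanS/subsetUr.
rewrite eq_sym (mxrank_leqif_eq sA).2 sA /= ptspan_sub subUset sub1set inE.
by rewrite -ptspan_sub submx_refl andbT.
Qed.

Lemma flatE (A : {set PG F n}) : flat A = (pts (ptspan A) == A).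
Proof. by rewrite /flat closureE. Qed.

Lemma rkE (A : {set PG F n}) : rk A = \rank (ptspan A).
Proof. by []. Qed.

Lemma rank_pts m (U : 'M[F]_(m, n)) : rk (pts U : {set PG F n}) = \rank U.
Proof. by rewrite rkE ptspan_pts. Qed.

Lemma eq_pts m1 m2 (U : 'M[F]_(m1, n)) (V : 'M[F]_(m2, n)) :
  (U :=: V)%MS -> pts U = pts V.
Proof. by move=> eUV; apply/setP=> x; rewrite !inE eUV. Qed.

Lemma flat_pts m (U : 'M[F]_(m, n)) : flat (pts U : {set PG F n}).
Proof. by rewrite flatE (eq_pts (ptspan_pts U)). Qed.

Lemma pts_sub m1 m2 (U : 'M[F]_(m1, n)) (V : 'M[F]_(m2, n)) :
  (pts U \subset pts V) = (U <= V)%MS.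
Proof. by rewrite -ptspan_sub ptspan_pts. Qed.

(* The chain of flats of a target coloring of the flat [U], peeled from the top;
   points of [G] outside [U] play no role. *)
Fixpoint tower (j : nat) (G : {set pg_point F n}) (U : 'M[F]_n) : Prop :=
  \rank U = j /\
  if j is i.+1 then
    exists V : 'M[F]_n, [/\ (V <= U)%MS, tower i G V
      & (pts U :\: pts V \subset G) || (pts U :\: pts V \subset ~: G)]
  else True.

(** * Towers under a change of the flat, of the coloring or of the rank *)

Lemma tower_rank j G U : tower j G U -> \rank U = j.
Proof. by case: j => [|j] []. Qed.

Lemma tower_eqmx j G U U' : (U :=: U')%MS -> tower j G U -> tower j G U'.
Proof.
case: j => [|j] eU [rU] /=; rewrite -eU //.
move=> [V [sVU tV c]]; split=> //; exists V.
by rewrite -eU -(eq_pts eU).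
Qed.

Lemma tower_eq j G G' U :
  G :&: pts U = G' :&: pts U -> tower j G U -> tower j G' U.
Proof.
elim: j U => [|j IH] U eG //= [rU [V [sVU tV c]]]; split=> //; exists V.
have inG x : x \in pts U -> (x \in G) = (x \in G').
  by move=> Ux; move/setP/(_ x): eG; rewrite !in_setI Ux !andbT.
split=> //.
  apply: IH tV; apply/setP=> x; rewrite !in_setI.
  by case Vx: (x \in pts V); rewrite ?andbF // inG // (subsetP _ x Vx) // pts_sub.
case/orP: c => /subsetP c; apply/orP; [left | right]; apply/subsetP=> x UVx;
  by have:= c x UVx; rewrite ?in_setC inG //; case/setDP: UVx.
Qed.

(* [V] grows by one point at a time, so the layers added above it are all red. *)
Lemma tower_extend k j G (U V : 'M[F]_n) :
    tower j G V -> (V <= U)%MS -> \rank U = k + j ->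
    [disjoint G & pts U :\: pts V] ->
  tower (k + j) G U.
Proof.
elim: k j V => [|k IH] j V tV sVU rU dG.
  apply: (tower_eqmx _ tV); apply/eqmxP.
  by rewrite -(mxrank_leqif_eq sVU).2 rU (tower_rank tV).
have /subsetPn[x] : ~~ (pts U \subset pts V).
  rewrite pts_sub; apply/negP=> /mxrankS.
  by rewrite rU (tower_rank tV) addSn leqNgt ltnS leq_addl.
rewrite !inE => Ux nVx.
have sVx : (V + val x <= U)%MS by rewrite addsmx_sub sVU.
rewrite addSnnS; apply: (IH _ (V + val x)%MS); rewrite -?addSnnS //.
  split; first by rewrite rank_add_pt ?(tower_rank tV).
  exists V; split; rewrite ?addsmxSl //; apply/orP; right.
  rewrite -disjoints_subset disjoint_sym.
  by apply: disjointWr dG; rewrite setSD // pts_sub.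
by apply: disjointWr dG; rewrite setDS // pts_sub addsmxSl.
Qed.

(** * Counting points by means of nonzero vectors *)

Definition vectors A : {set 'rV[F]_n} :=
  [set v | (v != 0%R) && [exists x in A, (v <= val x)%MS]].

Lemma vectors_pts m (U : 'M[F]_(m, n)) : vectors (pts U) = rowg U :\ 0%R.
Proof.
apply/setP=> v; rewrite !inE; case nzv: (v == 0%R) => //=.
apply/existsP/idP=> [[x /andP[]] | Uv].
  by rewrite inE => Ux vx; apply: submx_trans vx Ux.
have [|x ex] := @pt_of _ v; first by rewrite rank_rV nzv.
by exists x; rewrite inE !ex Uv submx_refl.
Qed.

Lemma card_rowg_nz m (U : 'M[F]_(m, n)) :
  #|rowg U :\ 0%R| = #|F| ^ \rank U - 1.
Proof.
by rewrite -card_rowg [in RHS](cardsD1 0%R) inE sub0mx addnC addnK.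
Qed.

Lemma card_vectors A : #|vectors A| = #|A| * (#|F| - 1).
Proof.
(* [L x] is empty for [x] outside [A], so the disjoint union may run over all points. *)
pose L x := if x \in A then rowg (val x) :\ 0%R else set0.
have -> : vectors A = \bigcup_x L x.
  apply/setP=> v; rewrite inE; apply/andP/bigcupP.
    by case=> nzv /existsP[x /andP[Ax vx]]; exists x; rewrite // /L Ax !inE nzv.
  case=> x _; rewrite /L; case: ifP => Ax; rewrite !inE // => /andP[nzv vx].
  by split=> //; apply/existsP; exists x; rewrite Ax.
rewrite -sum1_card partition_disjoint_bigcup => [|x y nxy]; last first.
  rewrite -setI_eq0; apply/eqP/setP=> v; rewrite /L !inE; apply: contraNF nxy.
  do 2!case: ifP; rewrite ?inE ?andbF // => _ _ /andP[/andP[nzv vx] /andP[_ vy]].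
  by apply/eqP/pt_eq; rewrite -(pt_row nzv vx).
rewrite -sum_nat_const [RHS]big_mkcond; apply: eq_bigr => x _.
rewrite sum1_card /L; case: ifP => _; last by rewrite cards0.
by rewrite card_rowg_nz rank_pt expn1.
Qed.

Lemma card_pts m (U : 'M[F]_(m, n)) :
  #|pts U| * (#|F| - 1) = #|F| ^ \rank U - 1.
Proof. by rewrite -card_vectors vectors_pts card_rowg_nz. Qed.

Lemma pt_vec x : exists2 v : 'rV[F]_n, v != 0%R & (v :=: val x)%MS.
Proof.
by exists (nz_row (val x)); [|apply: pt_row];
  rewrite ?nz_row_eq0 ?pt_neq0 ?nz_row_sub.
Qed.

Lemma mem_vectors x (v : 'rV[F]_n) A :
  v != 0%R -> (v :=: val x)%MS -> (v \in vectors A) = (x \in A).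
Proof.
move=> nzv ev; rewrite inE nzv /=; apply/existsP/idP=> [[y /andP[Ay]]|Ax].
  by rewrite ev => /pt_eq ->.
by exists x; rewrite Ax ev submx_refl.
Qed.

Lemma vectorsZ A (a : F) (v : 'rV[F]_n) :
  a != 0%R -> (a *: v \in vectors A)%R = (v \in vectors A).
Proof.
move=> nza; rewrite !inE scaler_eq0 (negPf nza) /=; congr andb.
by apply: eq_existsb => x; rewrite eqmx_scale.
Qed.

(* The counting behind the rigidity of affine geometries: a set with the size of
   an affine geometry that contains no full line is the complement of a
   hyperplane. If [g] is a vector of [S], every coset of the line of [g] meets the
   set [T] of vectors outside [S], and [#|T|] is the number of these cosets, so
   it meets [T] exactly once; hence no two vectors of [T] add up to [g]. *)
Lemma affine_complement j (U : 'M[F]_n) (S : {set pg_point F n}) :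
    \rank U = j.+1 -> S \subset pts U ->
    #|S| * (#|F| - 1) = #|F| ^ j.+1 - #|F| ^ j ->
    (forall x y, x \in S -> y \in S -> x != y ->
       exists2 z, (val z <= val x + val y)%MS & z \notin S) ->
  exists V : 'M[F]_n, [/\ (V <= U)%MS, \rank V = j & pts U :\: pts V = S].
Proof.
move=> rU sSU cS noline.
have q_gt1 : 1 < #|F| by apply: card_finNzRing_gt1.
pose T := rowg U :\: vectors S.
(* [T], which contains the zero vector, is to be the vector space of the hyperplane sought; its size
   is already right. *)
have cT : #|T| = #|F| ^ j.
  rewrite cardsDS; last first.
    apply/subsetP=> v; rewrite !inE => /andP[_ /existsP[x /andP[Sx vx]]].
    by apply: submx_trans vx _; have:= subsetP sSU x Sx; rewrite inE.
  by rewrite card_rowg card_vectors cS rU subKn // leq_pexp2l // ltnW.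
have TU v : v \in T -> (v <= U)%MS by rewrite !inE => /andP[].
have T0 : 0%R \in T by rewrite !inE eqxx sub0mx.
have TZ (a : F) v : v \in T -> (a *: v)%R \in T.
  have [-> | nza] := eqVneq a 0%R; first by rewrite scale0r.
  rewrite /T in_setD [v \in rowg _]inE => /andP[nSv Uv].
  by rewrite in_setD vectorsZ // nSv inE scalemx_sub.
have TD u v : u \in T -> v \in T -> (u + v)%R \in T.
  move=> Tu Tv; apply: contraT => nTg; set g := (u + v)%R in nTg.
  have Ug : (g <= U)%MS by rewrite addmx_sub ?TU.
  have Sg : g \in vectors S.
    by move: nTg; rewrite in_setD [g \in rowg U]inE Ug andbT negbK.
  have nzg : g != 0%R by move: Sg; rewrite inE => /andP[].
  pose f (ta : 'rV[F]_n * F) := (ta.1 + ta.2 *: g)%R.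
  pose D := setX T [set: F].
  have sUf : rowg U \subset f @: D.
    apply/subsetP=> w; rewrite inE => Uw.
    have [Tw | nTw] := boolP (w \in T).
      by apply/imsetP; exists (w, 0%R);
        rewrite ?in_setX ?Tw ?in_setT // /f /= scale0r addr0.
    have Sw : w \in vectors S.
      by move: nTw; rewrite in_setD [w \in rowg U]inE Uw andbT negbK.
    have [/sub_rVP[a ->] | ngw] := boolP (w <= g)%MS.
      by apply/imsetP; exists (0%R, a); rewrite ?in_setX ?T0 ?in_setT // /f /= add0r.
    move: Sg Sw; rewrite !inE nzg /= => /existsP[x /andP[Sx gx]].
    case/andP=> nzw /existsP[y /andP[Sy wy]].
    have nxy : x != y.
      by apply: contraNneq ngw => eyx; rewrite (pt_row nzg gx) eyx.
    (* The line through the points of [g] and [w] has a point outside [S], which gives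
       [t = a0 g + b0 w] in [T]. Here [b0] is nonzero, since otherwise [t] would be a multiple of
       [g], so the equation can be solved for [w]. *)
    have [z sz nSz] := noline x y Sx Sy nxy.
    have [t nzt et] := pt_vec z.
    have /sub_addsmxP[[a b] /= def_t] : (t <= g + w)%MS.
      by rewrite et (adds_eqmx (pt_row nzg gx) (pt_row nzw wy)).
    rewrite (mx11_scalar a) (mx11_scalar b) !mul_scalar_mx in def_t.
    set a0 := a _ _ in def_t; set b0 := b _ _ in def_t.
    have nTt : t \notin vectors S by rewrite (mem_vectors _ nzt et).
    have nzb : b0 != 0%R.
      apply: contraNneq nTt => b0E; move: nzt; rewrite def_t b0E scale0r addr0.
      rewrite scaler_eq0 negb_or => /andP[nza _]; rewrite vectorsZ // inE nzg.
      by apply/existsP; exists x; rewrite Sx.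
    have Tt : t \in T.
      rewrite in_setD nTt inE def_t.
      by apply: addmx_sub; apply: scalemx_sub.
    apply/imsetP; exists ((b0^-1 *: t)%R, (- (b0^-1 * a0))%R).
      by rewrite in_setX TZ ?in_setT.
    rewrite /f /= def_t scalerDr !scalerA mulVf // scale1r scaleNr.
    by rewrite addrAC subrr add0r.
  (* [D] has [#|F| ^ j.+1] elements, as many as [U] has vectors, so [f], which reaches all of these,
     is injective. *)
  have /imset_injP injf : #|f @: D| == #|D|.
    rewrite eqn_leq leq_imset_card /= cardsX cT cardsT -expnSr -rU -card_rowg.
    exact: subset_leq_card.
  (* Both pairs are sent to [u], although their second components differ. *)
  have fE : f (u, 0%R) = f (- v, 1)%R.
    by rewrite /f /= scale0r addr0 scale1r /g addrC addrK.
  have Du : (u, 0%R) \in D by rewrite in_setX Tu in_setT.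
  have Dv : ((- v)%R, 1%R) \in D by rewrite in_setX -scaleN1r TZ ?in_setT.
  by case: (injf _ _ Du Dv fE) => _ /esym/eqP; rewrite oner_eq0.
(* Being closed under linear combinations, [T] consists of all vectors of its span. *)
pose V := (\sum_(v in T) <<v>>)%MS.
have TV v : (v <= V)%MS = (v \in T).
  apply/idP/idP=> [/sub_sumsmxP[u_ ->] | Tv]; last first.
    by apply: (sumsmx_sup v); rewrite ?genmxE.
  apply: (big_ind (fun w => w \in T)) => // w Tw.
  have /sub_rVP[a ->] : ((u_ w *m <<w>>)%R <= w)%MS.
    by apply: submx_trans (submxMl _ _) _; rewrite genmxE.
  exact: TZ.
exists V; split.
- by apply/sumsmx_subP=> v Tv; rewrite genmxE TU.
- apply/eqP; rewrite -(eqn_exp2l _ _ q_gt1) -card_rowg -cT; apply/eqP.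
  by apply: eq_card => v; rewrite inE TV.
apply/setP=> x; rewrite in_setD !inE.
have [v nzv ev] := pt_vec x; rewrite -!ev TV in_setD (mem_vectors _ nzv ev) inE.
have [Sx | nSx] := boolP (x \in S); rewrite /= ?negbK; last by rewrite andNb.
by have:= subsetP sSU x Sx; rewrite inE ev.
Qed.

End Points.

(** * Independence of the target property from the embedding *)

Section Transfer.
Variable F : finFieldType.

(** A vector of [U] inside [V] is a difference of two vectors of [U] outside [V]: add and subtract a
    row of [U] that is not in [V]. *)
Lemma ptspan_compl n (U V : 'M[F]_n) :
  ~~ (U <= V)%MS -> (ptspan (pts U :\: pts V) :=: U)%MS.
Proof.
move=> /row_subPn[k nVk].
have outV (v : 'rV[F]_n) :
    (v <= U)%MS -> ~~ (v <= V)%MS -> (v <= ptspan (pts U :\: pts V))%MS.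
  move=> Uv nVv; have [|x ex] := @pt_of _ _ _ v.
    by rewrite rank_rV; case: eqP nVv => // ->; rewrite sub0mx.
  by rewrite -ex; apply: sub_ptspan; rewrite !inE !ex nVv.
apply/eqmxP; apply/andP; split; first by rewrite ptspan_sub subsetDl.
apply/row_subP=> i; have [Vi | nVi] := boolP (row i U <= V)%MS; last first.
  by rewrite outV ?row_sub.
rewrite -[row i U](addrK (row k U)) addmx_sub ?eqmx_opp ?outV ?row_sub //.
  by rewrite addmx_sub ?row_sub.
apply: contra nVk => Vik; rewrite -[row k U](addKr (row i U)).
by rewrite addmx_sub ?eqmx_opp.
Qed.

(** All points of [U] outside [V] are red, so any chain of flats from [V] up to [U] continues the
    tower. *)
Lemma tower_widen n j (G : {set pg_point F n}) (U V : 'M[F]_n) :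
  tower j G V -> (V <= U)%MS -> G \subset pts V -> tower (\rank U) G U.
Proof.
move=> tV sVU sGV; have le_j : j <= \rank U.
  by rewrite -(tower_rank tV) mxrankS.
rewrite -(subnK le_j); apply: (tower_extend tV) => //; first by rewrite subnK.
rewrite disjoints_subset; apply: subset_trans sGV _; apply/subsetP=> x Vx.
by rewrite in_setC in_setD Vx.
Qed.

(** The ranks of [V] and of the line add up to [j + 2] inside a space of rank [j + 1], so the two
    meet. *)
Lemma rank_line_cap n j (U V : 'M[F]_n) (x y : pg_point F n) :
    \rank U = j.+1 -> \rank V = j -> (V <= U)%MS -> x != y ->
    (val x <= U)%MS -> (val y <= U)%MS ->
  exists2 z : pg_point F n, (val z <= V)%MS & (val z <= val x + val y)%MS.
Proof.
move=> rU rV sVU nxy Ux Uy.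
have : (V :&: (val x + val y))%MS != 0%R.
  rewrite -mxrank_eq0 -lt0n -(ltn_add2l (\rank (V + (val x + val y))%MS)).
  rewrite mxrank_sum_cap rank_span2 // rV addn0 addn2 ltnS -rU mxrankS //.
  by rewrite !addsmx_sub sVU Ux.
by case/pt_below=> z; rewrite sub_capmx => /andP[]; exists z.
Qed.

(** [T] indexes the elements of one matroid, which [e] and [e'] represent in geometries of possibly
    different ranks. *)
Variables (T : finType) (n n' : nat).
Variables (e : T -> pg_point F n) (e' : T -> pg_point F n').
Hypotheses (inj_e : injective e) (inj_e' : injective e').
Hypothesis rk_ee' :
  forall A : {set T}, \rank (ptspan (e @: A)) = \rank (ptspan (e' @: A)).

(* In a flat ptspanned by green points whose top layer is green, that layer is an
   affine geometry, so its image under the other embedding is again the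
   complement of a hyperplane. *)
Lemma tower_transfer j (B : {set T}) (U : 'M[F]_n) (U' : 'M[F]_n') :
    tower j (e @: B) U -> e @: B \subset pts U -> e' @: B \subset pts U' ->
  tower (\rank U') (e' @: B) U'.
Proof.
elim: j B U U' => [|j IH] B U U' /=.
  move=> [rU _] sBU _; apply: (@tower_widen _ 0 _ _ 0%R); rewrite ?sub0mx //.
    by rewrite /= mxrank0.
  suff -> : B = set0 by rewrite imset0 sub0set.
  apply/setP=> b; rewrite in_set0; apply/negP=> Bb.
  have := subsetP sBU _ (imset_f e Bb); rewrite inE => /mxrankS.
  by rewrite rU rank_pt.
move=> [rU [V [sVU tV /orP[topG | topR]]]] sBU sBU'; last first.
  (* If the top layer is red, all green points already lie in [V]. *)
  apply: IH tV _ sBU'; apply/subsetP=> x Bx.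
  have := subsetP topR x; rewrite in_setD in_setC Bx (subsetP sBU) //.
  by case: (x \in pts V) => // /(_ isT).
pose B1 := [set b in B | e b \notin pts V].
pose B0 := [set b in B | e b \in pts V].
have eB1 : e @: B1 = pts U :\: pts V.
  apply/setP=> x; apply/imsetP/idP=> [[b] | topx].
    rewrite inE => /andP[Bb nVb] ->; rewrite in_setD nVb.
    by apply/(subsetP sBU)/imset_f.
  have /imsetP[b Bb def_x] := subsetP topG x topx; exists b => //.
  by rewrite inE Bb -def_x; case/setDP: topx.
have rV := tower_rank tV.
have ptspanB : (ptspan (e @: B) :=: U)%MS.
  apply/eqmxP; rewrite ptspan_sub sBU /=.
  rewrite -(@ptspan_compl _ U V) ?ptspanS //.
  by apply/negP=> /mxrankS; rewrite rU rV ltnn.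
(* [U'] may exceed the span [W] of the green points; the tower is built on [W] and widened to [U']
   at the end. *)
pose W := ptspan (e' @: B).
have rW : \rank W = j.+1 by rewrite -rk_ee' ptspanB.
have sWU' : (W <= U')%MS by rewrite ptspan_sub.
have [||x y|V' [sV'W rV' topE]] := affine_complement rW (S := e' @: B1).
- rewrite -ptspan_sub ptspanS //; apply: imsetS.
  by apply/subsetP=> b; rewrite inE => /andP[].
- rewrite card_imset // -(card_imset _ inj_e) eB1 cardsDS ?pts_sub //.
  rewrite mulnBl !card_pts rU rV subnBA ?subnK //;
    by rewrite expn_gt0 ltnW ?card_finNzRing_gt1.
(* A full line inside [e' @: B1] would pull back to a set of rank 2 with as many points as a line,
   hence to the full line through [e a] and [e b]. That line meets [V], whereas [e @: B1] avoids
   [V]. *)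
- case/imsetP=> a B1a -> /imsetP[b B1b ->] nab.
  have {}nab : a != b by apply: contraNneq nab => ->.
  have inU c : c \in B1 -> (val (e c) <= U)%MS.
    rewrite inE => /andP[Bc _].
    by have := subsetP sBU _ (imset_f e Bc); rewrite inE.
  have [|z Vz abz] := rank_line_cap rU rV sVU _ (inU a B1a) (inU b B1b).
    by rewrite (inj_eq inj_e).
  have [sab|] := boolP (pts (val (e' a) + val (e' b))%MS \subset e' @: B1).
    pose C := [set c in B1 | e' c \in pts (val (e' a) + val (e' b))%MS].
    have e'C : e' @: C = pts (val (e' a) + val (e' b))%MS.
      apply/setP=> x'; apply/imsetP/idP=> [[c] | abx].
        by rewrite inE => /andP[_ abc] ->.
      have /imsetP[c B1c def_x] := subsetP sab x' abx.
      by exists c; rewrite // inE B1c -def_x.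
    have abC : [set a; b] \subset C.
      by apply/subsetP=> c /set2P[]->; rewrite !inE ?addsmxSl ?addsmxSr;
        rewrite !inE in B1a B1b; rewrite ?B1a ?B1b.
    have rab : \rank (val (e a) + val (e b))%MS = 2.
      by rewrite rank_span2 // (inj_eq inj_e).
    have eC : e @: C = pts (val (e a) + val (e b))%MS.
      apply/eqP; rewrite eqEcard; apply/andP; split.
        have sabC : (val (e a) + val (e b) <= ptspan (e @: C))%MS.
          rewrite addsmx_sub !sub_ptspan ?imset_f //;
          by apply: (subsetP abC); rewrite !inE eqxx ?orbT.
        rewrite -ptspan_sub -(mxrank_leqif_sup sabC).2 rab.
        by rewrite rk_ee' e'C ptspan_pts rank_span2 // (inj_eq inj_e').
      rewrite card_imset // -(card_imset _ inj_e') e'C.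
      have q1 : 0 < #|F| - 1 by rewrite subn_gt0 card_finNzRing_gt1.
      rewrite -(leq_pmul2r q1) !card_pts rab.
      by rewrite rank_span2 // (inj_eq inj_e').
    have : z \in e @: C by rewrite eC inE.
    case/imsetP=> c; rewrite !inE => /andP[/andP[_ /negP nVc] _] def_z.
    by case: nVc; rewrite -def_z.
  by case/subsetPn=> z'; rewrite inE => *; exists z'.
have tW : tower j.+1 (e' @: B) W.
  split=> //; exists V'; split=> //; last first.
    apply/orP; left; rewrite topE; apply: imsetS.
    by apply/subsetP=> b; rewrite inE => /andP[].
  have sB0 : e' @: B0 \subset pts V'.
    apply/subsetP=> _ /imsetP[b B0b ->]; move: (B0b); rewrite inE => /andP[Bb Vb].
    have := in_setD (pts W) (pts V') (e' b); rewrite topE (mem_imset _ _ inj_e').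
    have -> : e' b \in pts W by rewrite inE sub_ptspan ?imset_f.
    by rewrite inE Bb Vb andbT => /esym/negbFE.
  (* The green points inside [V'] are those of [e' @: B0] and the ones inside [V] are those of
     [e @: B0], so the induction hypothesis applies to [B0]. *)
  rewrite -{1}rV'; apply: tower_eq (IH B0 V V' _ _ sB0).
  - apply/setP=> x; rewrite !in_setI; case Vx: (x \in pts V'); rewrite ?andbF // !andbT.
    apply/imsetP/imsetP=> [] [b]; rewrite ?inE.
      by case/andP=> Bb _ ->; exists b.
    move=> Bb def_x; exists b; rewrite // inE Bb; apply: contraLR Vx => nVb.
    have : x \in pts W :\: pts V' by rewrite topE def_x imset_f // inE Bb.
    by case/setDP.
  - apply: tower_eq tV; apply/setP=> x; rewrite !in_setI.
    case Vx: (x \in pts V); rewrite ?andbF // !andbT.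
    apply/imsetP/imsetP=> [] [b]; rewrite ?inE.
      by move=> Bb def_x; exists b; rewrite // inE Bb -def_x.
    by case/andP=> Bb _ ->; exists b.
  - by apply/subsetP=> _ /imsetP[b B0b ->]; move: B0b; rewrite inE => /andP[].
by apply: tower_widen tW sWU' _; rewrite -ptspan_sub.
Qed.

End Transfer.

(** * Equivalence of target colorings and towers *)

Lemma target_coloring_tower (F : finFieldType) r (G : {set PG F r}) :
  target_coloring G <-> tower r G 1%:M.
Proof.
split=> [[Fl [flatF sF cF]] | tG].
  have tF j : j <= r -> tower j G (ptspan (Fl j)).
    elim: j => [|j IH] le_jr; split; rewrite -?rkE ?(flatF _ le_jr).2 //.
    exists (ptspan (Fl j)); split; first exact/ptspanS/sF.
      exact/IH/ltnW.
    have := cF j.+1; rewrite le_jr => /(_ isT).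
    have /flatF[] := le_jr; rewrite flatE => /eqP -> _.
    by have /flatF[] := ltnW le_jr; rewrite flatE => /eqP -> _.
  have tr := tF r (leqnn r); apply: (tower_eqmx _ tr); apply/eqmxP.
  by rewrite -(mxrank_leqif_eq (submx1 _)).2 (tower_rank tr) mxrank1.
(* A tower holds its flats in nested existentials; here they are gathered into one function of the
   rank. *)
have chain j U : tower j G U -> exists Us : nat -> 'M[F]_r,
    [/\ Us j = U, forall i, i <= j -> \rank (Us i) = i
    & forall i, i < j -> (Us i <= Us i.+1)%MS /\
       ((pts (Us i.+1) :\: pts (Us i) \subset G)
     || (pts (Us i.+1) :\: pts (Us i) \subset ~: G))].
  elim: j U => [|j IH] U /=.
    by case=> rU _; exists (fun=> U); split=> // i; rewrite leqn0 => /eqP ->.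
  case=> rU [V [sVU /IH[Us [UsV rUs sUs]] cV]].
  exists (fun i => if i == j.+1 then U else Us i); split; first by rewrite eqxx.
    by move=> i; case: eqP => [-> | /eqP ne] //; rewrite leq_eqVlt (negPf ne) => /rUs.
  move=> i lt_ij; rewrite (ltn_eqF lt_ij) eqSS; move: lt_ij; rewrite ltnS => le_ij.
  by case: eqP => [-> | /eqP ne]; [rewrite UsV | apply: sUs; rewrite ltn_neqAle ne].
have [Us [_ rUs sUs]] := chain r _ tG; exists (fun i => pts (Us i)); split.
- by move=> j le_jr; rewrite flat_pts rank_pts rUs.
- by move=> j /sUs[]; rewrite pts_sub.
- by case=> // i /= /sUs[].
Qed.

(** * Projection from a point onto a hyperplane that avoids it *)

Section Projection.
Variables (F : finFieldType) (n : nat) (H : 'M[F]_n) (p : pg_point F n).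
Hypotheses (rH : (\rank H).+1 = n) (Hp : ~~ (val p <= H)%MS).
Implicit Types x y h : pg_point F n.

(** [H + U] contains [H] and [p], hence is the whole space, and the dimension formula applies. *)
Lemma rank_cap_hyperplane (U : 'M[F]_n) :
  (val p <= U)%MS -> (\rank (H :&: U)%MS).+1 = \rank U.
Proof.
move=> Up; have := mxrank_sum_cap H U.
have -> : \rank (H + U)%MS = n.
  apply/eqP; rewrite eqn_leq rank_leq_row /= -{1}rH -(rank_add_pt Hp) mxrankS //.
  by rewrite addsmxS.
by rewrite -{1}rH addSn -addnS => /addnI.
Qed.

Lemma line_eqmx x y : x != p -> y != p ->
  (val x <= val p + val y)%MS -> (val p + val x :=: val p + val y)%MS.
Proof.
move=> nxp nyp sx.
have s : (val p + val x <= val p + val y)%MS by rewrite addsmx_sub addsmxSl.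
by apply/eqmxP; rewrite -(mxrank_leqif_eq s).2 !rank_span2 // eq_sym.
Qed.

Lemma neq_apex h : (val h <= H)%MS -> h != p.
Proof. by apply: contraTneq => ->. Qed.

Lemma project x : x != p ->
  exists2 h : pg_point F n, (val h <= H)%MS & (val p + val h :=: val p + val x)%MS.
Proof.
move=> nxp; have r1 : \rank (H :&: (val p + val x))%MS = 1.
  by apply: succn_inj; rewrite rank_cap_hyperplane ?addsmxSl // rank_span2 // eq_sym.
have [h eh] := pt_of r1.
have : (val h <= H :&: (val p + val x))%MS by rewrite eh.
rewrite sub_capmx => /andP[Hh sh]; exists h => //.
exact: line_eqmx (neq_apex Hh) nxp sh.
Qed.

Lemma project_uniq h h' x :
    (val h <= H)%MS -> (val h' <= H)%MS -> x != p ->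
    (val h <= val p + val x)%MS -> (val h' <= val p + val x)%MS ->
  h = h'.
Proof.
move=> Hh Hh' nxp sh sh'; have r1 : \rank (H :&: (val p + val x))%MS = 1.
  by apply: succn_inj; rewrite rank_cap_hyperplane ?addsmxSl // rank_span2 // eq_sym.
have [k ek] := pt_of r1.
by transitivity k; [|symmetry]; apply: pt_eq; rewrite ek sub_capmx ?Hh ?Hh'.
Qed.

End Projection.

Lemma ptspan_setT (F : finFieldType) n :
  (ptspan [set: pg_point F n] :=: (1%:M%R : 'M[F]_n))%MS.
Proof.
have -> : [set: pg_point F n] = pts (1%:M%R : 'M[F]_n).
  by apply/setP=> x; rewrite !inE submx1.
exact: ptspan_pts.
Qed.

(** * Conings of target colorings *)

Section Coning.
Variables (F : finFieldType) (r : nat) (G : {set pg_point F r}).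
Variables (iota : pg_point F r -> pg_point F r.+1).
Variables (p : pg_point F r.+1) (tip : bool).
Hypothesis emb : hyperplane_embedding iota.
Hypothesis ap : p \notin iota @: [set: pg_point F r].

Let H := ptspan (iota @: [set: pg_point F r]).
Let G' : {set pg_point F r.+1} := coning_green G iota p tip.

Let iota_inj : injective iota. Proof. by case: emb. Qed.

Let rank_iota (A : {set pg_point F r}) :
  \rank (ptspan (iota @: A)) = \rank (ptspan A).
Proof. by case: emb => _ /(_ A). Qed.

Let ptsH : pts H = iota @: [set: pg_point F r].
Proof. by case: emb => _ _ /andP[]; rewrite flatE => /eqP. Qed.

Let iotaH z : (val (iota z) <= H)%MS.
Proof. by rewrite sub_ptspan ?imset_f. Qed.

Let rankH : (\rank H).+1 = r.+1.
Proof. by rewrite rank_iota ptspan_setT mxrank1. Qed.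

Let apexH : ~~ (val p <= H)%MS.
Proof. by have := ap; rewrite -ptsH inE. Qed.

(** The existential in [coning_green] has [z] as its only candidate, because the projection to [H]
    is unique and [iota] is injective. *)
Lemma coning_greenE x z : x != p ->
    (val p + val (iota z)
       :=: val p + val x)%MS ->
  (x \in G') = (z \in G).
Proof.
move=> nxp ez; rewrite inE (negPf nxp).
apply/existsP/idP=> [[z' /andP[Gz']] | Gz]; last first.
  by exists z; rewrite Gz closureE inE ptspan_set2 ez addsmxSr.
rewrite closureE inE ptspan_set2 => sx.
have ez' := line_eqmx nxp (neq_apex apexH (iotaH z')) sx.
rewrite (iota_inj (project_uniq rankH apexH (iotaH z) (iotaH z') nxp _ _)) //.
  by rewrite -ez addsmxSr.
by rewrite ez' addsmxSr.
Qed.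

Let cone (U : 'M[F]_r) := (ptspan (iota @: pts U) + val p)%MS.

(** By the modular law [cone U] meets [H] in the span of [iota @: pts U]. As [iota] preserves ranks,
    [iota z] lies in that span only if [z] lies in the closure of [pts U]. *)
Let cone_project (U : 'M[F]_r) z :
  (val (iota z) <= cone U)%MS = (z \in pts U).
Proof.
have sUH : (ptspan (iota @: pts U) <= H)%MS by rewrite ptspanS ?imsetS ?subsetT.
apply/idP/idP=> [sz | Uz]; last first.
  by apply: submx_trans (addsmxSl _ _); rewrite sub_ptspan ?imset_f.
have {sz} sz : (val (iota z) <= ptspan (iota @: pts U))%MS.
  have : (val (iota z) <= cone U :&: H)%MS.
    by rewrite sub_capmx sz iotaH.
  rewrite -(matrix_modl (val p) sUH) capmxC.
  by rewrite (cap_pt apexH) addsmx0.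
have := flat_pts U; rewrite /flat => /eqP <-.
rewrite inE !rkE -!rank_iota imsetU1 ptspan_setU ptspan_set1.
by rewrite (addsmx_idPr sz).
Qed.

Lemma tower_coning j (U : 'M[F]_r) : tower j G U -> tower j.+1 G' (cone U).
Proof.
have rcone (V : 'M[F]_r) : \rank (cone V) = (\rank V).+1.
  rewrite /cone rank_add_pt ?rank_iota ?ptspan_pts //.
  apply: contra apexH => /submx_trans-> //.
  by rewrite ptspanS ?imsetS ?subsetT.
elim: j U => [|j IH] U; [case=> rU _ | case=> rU [V [sVU tV cV]]].
  split; first by rewrite rcone rU.
  exists 0%R; split; rewrite ?sub0mx //; first by rewrite /= mxrank0.
  (* The cone over a flat of rank 0 is the point [p] alone, a layer of one color for either value of
     [tip]. *)
  suff sp x : x \in pts (cone U) :\: pts (0%R : 'M[F]_r.+1) -> x = p.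
    apply/orP; case Gp: (p \in G'); [left|right]; apply/subsetP=> x /sp ->//.
    by rewrite inE Gp.
  case/setDP; rewrite inE => sx _; apply: pt_eq; apply: submx_trans sx _.
  have := rank_iota (pts U); rewrite ptspan_pts rU => /eqP; rewrite mxrank_eq0.
  by move/eqP=> E; rewrite /cone E adds0mx.
split; first by rewrite rcone rU.
exists (cone V); split; last 2 first.
- exact: IH.
(* A point of the new layer has the color of its projection, which comes from a point of [U] outside
   [V]. *)
- have color x : x \in pts (cone U) :\: pts (cone V) ->
      exists2 z, z \in pts U :\: pts V & (x \in G') = (z \in G).
    case/setDP; rewrite [x \in pts _]inE => Ux; rewrite [x \in pts _]inE => nVx.
    have nxp : x != p by apply: contraNneq nVx => ->; apply: addsmxSr.
    have [h Hh eh] := project rankH apexH nxp.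
    have /imsetP[z _ def_h] : h \in iota @: [set: pg_point F r] by rewrite -ptsH inE.
    rewrite def_h in eh; exists z; last exact: coning_greenE.
    have sz m (W : 'M[F]_(m, r.+1)) : (val p <= W)%MS ->
        (val (iota z) <= W)%MS = (val x <= W)%MS.
      move=> sp; have: (val p + val (iota z) <= W)%MS = (val p + val x <= W)%MS.
        by rewrite eh.
      by rewrite !addsmx_sub sp.
    by rewrite in_setD -!cone_project !sz ?addsmxSr // Ux nVx.
  case/orP: cV => /subsetP cV; apply/orP; [left | right];
    apply/subsetP=> x /color[z /cV]; rewrite ?in_setC => Gz -> //.
- by rewrite addsmxS // ptspanS ?imsetS ?pts_sub.
Qed.

Lemma target_coloring_coning :
  target_coloring G -> target_coloring (coning_green G iota p tip).
Proof.
move/target_coloring_tower/tower_coning=> tc; apply/target_coloring_tower.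
apply: (tower_eqmx _ tc); apply/eqmxP.
by rewrite -(mxrank_leqif_eq (submx1 _)).2 (tower_rank tc) mxrank1.
Qed.

End Coning.

(** * Removing the lowest point of the chain *)

Section Apex.
Variable F : finFieldType.

(** The point [p] is the flat of rank 1. All higher flats contain it, so a line of [U] through [p],
    with [p] removed, lies in one layer, and a hyperplane avoiding [p] lowers the rank of each of
    these flats by one. *)
Lemma tower_apex n j (G : {set pg_point F n}) (U : 'M[F]_n) :
    tower j.+1 G U ->
  exists p : pg_point F n,
    [/\ (val p <= U)%MS,
        forall x y, x != p -> y != p -> (val x <= U)%MS ->
          (val p + val x :=: val p + val y)%MS -> (x \in G) = (y \in G)
      & forall H : 'M[F]_n, (\rank H).+1 = n -> ~~ (val p <= H)%MS ->
          tower j G (H :&: U)%MS].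
Proof.
elim: j U => [|j IH] U [rU [V [sVU tV cV]]].
  have [p ep] := pt_of rU; exists p; split; first by rewrite ep.
    by move=> x y nxp _; rewrite -ep ptE (negPf nxp).
  move=> H rH Hp; split=> //; apply: succn_inj.
  by rewrite (rank_cap_hyperplane rH Hp) ?rU ?ep.
have [p [Vp cp tp]] := IH V tV; have Up := submx_trans Vp sVU.
exists p; split=> // [x y nxp nyp Ux exy | H rH Hp].
  have sxy (W : 'M[F]_n) : (val p <= W)%MS -> (val x <= W)%MS = (val y <= W)%MS.
    move=> sp; have: (val p + val x <= W)%MS = (val p + val y <= W)%MS
      by rewrite exy.
    by rewrite !addsmx_sub sp.
  have [Vx | nVx] := boolP (val x <= V)%MS; first exact: cp.
  have topx : x \in pts U :\: pts V by rewrite !inE nVx.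
  have topy : y \in pts U :\: pts V by rewrite !inE -!sxy // nVx.
  by case/orP: cV => /subsetP cV; have := cV x topx; have := cV y topy;
    rewrite ?in_setC; do 2!case: (_ \in G).
split; first by apply: succn_inj; rewrite (rank_cap_hyperplane rH Hp) ?rU.
exists (H :&: V)%MS; split; [by rewrite capmxS | exact: tp |].
apply/orP; case/orP: cV => cV; [left | right]; apply: subset_trans cV;
  apply/subsetP=> x; rewrite !inE !sub_capmx; by do 2!case: (_ <= _)%MS => //=.
Qed.

Variables (m n : nat) (E : 'M[F]_(m, n)) (iota : pg_point F m -> pg_point F n).
Hypothesis freeE : row_free E.
Hypothesis iotaE : forall x, (val (iota x) :=: (val x *m E)%R)%MS.

(** Multiplication by [pinvmx E] inverts multiplication by [E] on subspaces of the row space of [E];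
    the generated matrix makes the result square, as [tower] requires. *)
Lemma tower_pullback j (G : {set pg_point F n}) (U : 'M[F]_n) :
  tower j G U -> (U <= E)%MS -> tower j (iota @^-1: G) <<U *m pinvmx E>>%MS.
Proof.
have rk (W : 'M[F]_n) : (W <= E)%MS -> \rank <<W *m pinvmx E>>%MS = \rank W.
  by move=> sWE; rewrite genmxE -(mxrankMfree _ freeE) mulmxKpV.
have memp x (W : 'M[F]_n) : (W <= E)%MS ->
    (x \in pts <<W *m pinvmx E>>%MS) = (iota x \in pts W).
  by move=> sWE; rewrite !inE genmxE iotaE -{2}(mulmxKpV sWE) submxMfree.
elim: j U => [|j IH] U [rU] => [_ sUE | [V [sVU tV cV]] sUE]; split; rewrite ?rk //.
have sVE := submx_trans sVU sUE.
exists <<V *m pinvmx E>>%MS; split; [| exact: IH |].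
  by rewrite !genmxE submxMr.
by apply/orP; case/orP: cV => /subsetP cV; [left | right]; apply/subsetP=> x;
  rewrite in_setD !memp // => topx; have := cV (iota x);
  rewrite in_setD topx !inE => /(_ isT).
Qed.

Lemma ptspan_imset (A : {set pg_point F m}) :
  (ptspan (iota @: A) :=: (ptspan A *m E)%R)%MS.
Proof.
apply/eqmxP/andP; split.
  rewrite ptspan_sub; apply/subsetP=> _ /imsetP[x Ax ->].
  by rewrite inE iotaE submxMr ?sub_ptspan.
rewrite sumsmxMr_gen; apply/sumsmx_subP=> x Ax.
by rewrite genmxE -iotaE sub_ptspan ?imset_f.
Qed.

End Apex.

Lemma linear_hyperplane_embedding (F : finFieldType) r (E : 'M[F]_(r, r.+1))
    (iota : PG F r -> PG F r.+1) :
    row_free E ->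
    (forall x : pg_point F r,
       (val (iota x : pg_point F r.+1) :=: (val x *m E)%R)%MS) ->
  hyperplane_embedding iota /\ iota @: [set: PG F r] = pts E.
Proof.
move=> freeE iotaE.
have iotaT : iota @: [set: PG F r] = pts E.
  apply/setP=> x; rewrite inE; apply/imsetP/idP=> [[z _ ->] | Ex].
    by rewrite iotaE submxMl.
  have [|z ez] := @pt_of F _ _ (val x *m pinvmx E)%R.
    by rewrite -(mxrankMfree _ freeE) mulmxKpV ?rank_pt.
  exists z => //; apply: pt_eq; rewrite iotaE (eqmxMr E ez) mulmxKpV //.
have rE : \rank E = r by apply/eqP.
split=> //; split.
- move=> x y exy; apply: pt_eq; rewrite -(submxMfree _ _ freeE) -!iotaE exy.
  exact: submx_refl.
- by move=> A; rewrite !rkE (ptspan_imset iotaE) mxrankMfree.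
- rewrite /hyperplane iotaT flat_pts rank_pts rE andTb.
  by rewrite rkE ptspan_setT mxrank1.
Qed.

(** * Colorings up to isomorphism and the two inclusions *)

Lemma matroid_iso_refl (M : matroid) : matroid_iso M M.
Proof.
exists id; split; first by exists id.
by move=> A; rewrite imset_id.
Qed.

(** Both colorings are indexed by the ground set of [M]: composing the isomorphisms with [val] gives
    two representations with the same ranks, to which [tower_transfer] applies. *)
Lemma target_coloring_iso (F : finFieldType) (M : matroid) r r'
    (G : {set PG F r}) (G' : {set PG F r'}) :
    matroid_iso M (restriction G) -> matroid_iso M (restriction G') ->
  target_coloring G -> target_coloring G'.
Proof.
move=> [f [bij_f rk_f]] [f' [bij_f' rk_f']] /target_coloring_tower tG.
pose e x : pg_point F r := val (f x).
pose e' x : pg_point F r' := val (f' x).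
have imT (s : nat) (K : {set PG F s}) (g : M -> restriction K) :
    bijective g -> (fun x => val (g x)) @: [set: M] = K.
  move=> [h hK gK]; apply/setP=> x; apply/imsetP/idP=> [[y _ ->] | Kx].
    exact: valP.
  by exists (h (Sub x Kx)); rewrite // gK.
have rk_e (A : {set M}) : \rank (ptspan (e @: A)) = \rank (ptspan (e' @: A)).
  have <- : rk (f @: A) = \rank (ptspan (e @: A)).
    by rewrite /rk /= /restr_rk -imset_comp.
  have <- : rk (f' @: A) = \rank (ptspan (e' @: A)).
    by rewrite /rk /= /restr_rk -imset_comp.
  by rewrite rk_f rk_f'.
have ie : injective e by move=> x y /val_inj; apply: bij_inj.
have ie' : injective e' by move=> x y /val_inj; apply: bij_inj.
apply/target_coloring_tower.
have eG : e @: [set: M] = G := imT _ _ _ bij_f.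
have eG' : e' @: [set: M] = G' := imT _ _ _ bij_f'.
rewrite -eG in tG; rewrite -eG' -[X in tower X](mxrank1 F r').
by apply: (tower_transfer ie ie' rk_e tG); apply/subsetP=> x _; rewrite inE submx1.
Qed.

Lemma ex_row_base (F : fieldType) m n r (A : 'M[F]_(m, n)) :
  \rank A = r -> exists2 E : 'M[F]_(r, n), row_free E & (E :=: A)%MS.
Proof.
by move=> <-; exists (row_base A); [apply: row_base_free | apply: eq_row_base].
Qed.

Lemma target_obtained (F : finFieldType) r (G : {set PG F r}) (M : matroid) :
  target_coloring G -> matroid_iso M (restriction G) -> obtained_by_conings F M.
Proof.
elim: r G M => [|r IH] G M /target_coloring_tower tG isoM.
  apply: Obtained_empty; case: isoM => f [bij_f rk_f].
  (* A geometry of rank 0 has no points, since an empty matrix cannot have rank 1. *)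
  have no (x : M) : False.
    by have := rank_pt (val (f x) : pg_point F 0); rewrite thinmx0 mxrank0.
  exists (fun x => False_rect void (no x)); split.
    by exists (fun v : void => match v with end) => [x | []]; case: (no x).
  move=> A; have -> : A = set0 by apply/setP=> x; case: (no x).
  by have := rk_card (set0 : {set M}); rewrite cards0 leqn0 => /eqP ->.
have [p [_ colorp chainp]] := tower_apex tG.
(* Any complement of [p] can serve as the hyperplane of the coning; a row basis [E] identifies it
   with the geometry of rank [r]. *)
pose C := ((val p)^C)%MS.
have rC : \rank C = r by rewrite mxrank_compl rank_pt subn1.
have Cp : ~~ (val p <= C)%MS.
  apply/negP=> sp; have /eqP[] := pt_neq0 p; apply/eqP.
  by rewrite -submx0 -(capmx_compl (val p)) sub_capmx submx_refl.
have [E freeE eqE] := ex_row_base rC.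
have /fin_all_exists[iota iotaE] (x : pg_point F r) :
    exists y : pg_point F r.+1, (val y :=: (val x *m E)%R)%MS.
  by apply: pt_of; rewrite mxrankMfree ?rank_pt.
have [emb iotaT] := linear_hyperplane_embedding freeE iotaE.
have ap : p \notin iota @: [set: PG F r] by rewrite iotaT inE eqE.
have rC1 : (\rank C).+1 = r.+1 by rewrite rC.
have tG0 : target_coloring (iota @^-1: G : {set PG F r}).
  apply/target_coloring_tower.
  have tC : tower r G C.
    by rewrite -[C]capmx1; apply: chainp.
  have tP := tower_pullback freeE iotaE tC; rewrite eqE in tP.
  have {}tP := tP (submx_refl _); apply: (tower_eqmx _ tP); apply/eqmxP.
  by rewrite -(mxrank_leqif_eq (submx1 _)).2 (tower_rank tP) mxrank1.
(* Away from [p] both colorings are constant along lines through [p], so it suffices to compare them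
   on the hyperplane. *)
have GE : coning_green (iota @^-1: G) iota p (p \in G) = G.
  apply/setP=> x; have [-> | nxp] := eqVneq x p; first by rewrite inE eqxx.
  have [h Ch eh] := project rC1 Cp nxp.
  have /imsetP[z _ def_h] : h \in iota @: [set: PG F r] by rewrite iotaT inE eqE.
  rewrite def_h in eh; rewrite (coning_greenE _ _ emb ap nxp eh) inE.
  apply: colorp => //; last by rewrite submx1.
  by rewrite -def_h (neq_apex Cp).
have coneM : q_coning F (p \in G) (restriction (iota @^-1: G : {set PG F r})) M.
  exists r, (iota @^-1: G), iota, p; split=> //; first exact: matroid_iso_refl.
  by rewrite GE.
have obt := IH _ _ tG0 (matroid_iso_refl _).
by move: coneM; case: (p \in G);
  [apply: Obtained_tipped obt | apply: Obtained_tipless obt].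
Qed.

Theorem theorem3p6 (q : nat) (q_pp : prime_power q)
    (F : finFieldType) (cardF : #|F| = q) (M : matroid) :
  projective_target F M <-> obtained_by_conings F M.
Proof.
split=> [[r [G [tG isoM]]] | ]; first exact: target_obtained tG isoM.
have coning_target tip M' N' : projective_target F M' -> q_coning F tip M' N' ->
    projective_target F N'.
  move=> [r0 [G0 [tG0 iso0]]] [r [G [iota [p [isoG emb ap isoN]]]]].
  exists r.+1, (coning_green G iota p tip); split=> //.
  (* [G] is the coloring chosen by the coning and [G0] the one known to be a target; both represent
     the same matroid. *)
  exact/target_coloring_coning/(target_coloring_iso iso0 isoG).
elim=> {M} [M isoM | M N _ IH | M N _ IH]; [| exact: coning_target IH..].
exists 0, set0; split.
  by apply/target_coloring_tower; split; rewrite ?mxrank1.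
case: isoM => f [bij_f rk_f].
have no (x : M) : False by case: (f x).
have no' (x : restriction (set0 : {set PG F 0})) : False.
  by have := valP x; rewrite inE.
exists (fun x => False_rect _ (no x)); split.
  by exists (fun x => False_rect M (no' x)) => x; [case: (no x) | case: (no' x)].
move=> A; have -> : A = set0 by apply/setP=> x; case: (no x).
rewrite imset0; apply/eqP; rewrite eq_sym eqn_leq.
have := rk_card (set0 : {set M}); rewrite cards0 leqn0 => /eqP ->.
by have := rk_card (set0 : {set restriction (set0 : {set PG F 0})}); rewrite cards0.
Qed.
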